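(* Let $G$ be a group with identity $e$, let $R$ be a $G$-graded commutative ring with nonzero unity, and let $M$ be a $G$-graded unitary $R$-module. Let $g\in G$ and $0\neq m\in M_g$ be such that $R_em\neq M_g$ and $(0:_Rm)=\{0\}$. If $Rm$ is not a $g$-prime $R$-submodule of $M$, then $Rm$ is not a $g$-$\phi_1$-prime $R$-submodule of $M$.
   Context: $G$ is a group with identity $e$. $R=\bigoplus_{h\in G}R_h$ is a $G$-graded commutative ring with nonzero unity $1$ ($R_h$ additive subgroups, $R_hR_k\subseteq R_{hk}$), and $M=\bigoplus_{h\in G}M_h$ is a $G$-graded unitary $R$-module ($M_h$ additive subgroups, $R_hM_k\subseteq M_{hk}$). An $R$-submodule $K$ of $M$ is graded if $K=\bigoplus_{h\in G}(K\cap M_h)$; write $K_h=K\cap M_h$. For $m\in M_g$ the submodule $Rm$ is graded, with $(Rm)_g=R_em$. Notation: $(K:_RM)=\{r\in R: rM\subseteq K\}$; $(0:_Rm)=\{r\in R: rm=0\}$. For a graded $R$-submodule $K$ of $M$, $\phi_1(K)=(K:_RM)K$. $K-\phi_1(K)$ denotes set difference. Let $g\in G$ and let $K$ be a graded $R$-submodule of $M$ with $K_g\neq M_g$. - $K$ is a $g$-$\phi_1$-prime $R$-submodule of $M$ if whenever $r\in R_e$ and $x\in M_g$ satisfy $rx\in K-\phi_1(K)$, then $x\in K$ or $r\in(K:_RM)$. - $K$ is a $g$-prime $R$-submodule of $M$ if whenever $r\in R_e$ and $x\in M_g$ satisfy $rx\in K$, then $x\in K$ or $r\in(K:_RM)$.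 *)

(* Defs.v *)
From mathcomp Require Import all_boot all_order all_algebra.
From mathcomp Require Import finmap boolp classical_sets functions cardinality fsbigop.

Set Implicit Arguments.
Unset Strict Implicit.
Unset Printing Implicit Defensive.

Import GRing.Theory.
Local Open Scope classical_set_scope.
Local Open Scope ring_scope.

(* The grading group is written multiplicatively in [group_scope] (delimiter
   [%g]); its identity is [1%g].  It may be infinite and non-commutative. *)

Definition decomposition (G : choiceType) (V : zmodType) (A : G -> set V)
    (x : V) (f : G -> V) : Prop :=
  [/\ finite_set [set h | f h != 0], forall h, A h (f h)
    & x = \sum_(h \in [set: G]) f h].

(* [K] is assumed closed under addition wherever this is used, so it contains
   all the sums of elements of the [A h]. *)
Definition internal_direct_sum (G : choiceType) (V : zmodType)
    (A : G -> set V) (K : set V) : Prop :=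
  (forall h, A h `<=` K) /\
  (forall x, K x -> exists! f : G -> V, decomposition A x f).

Definition graded_ring (G : groupType) (R : comNzRingType)
    (Rg : G -> set R) : Prop :=
  [/\ forall h, zmod_closed [in Rg h],
      internal_direct_sum Rg [set: R]
    & forall h k a b, Rg h a -> Rg k b -> Rg (h * k)%g (a * b)].

Definition graded_module (G : groupType) (R : comNzRingType)
    (Rg : G -> set R) (M : lmodType R) (Mg : G -> set M) : Prop :=
  [/\ forall h, zmod_closed [in Mg h],
      internal_direct_sum Mg [set: M]
    & forall h k a x, Rg h a -> Mg k x -> Mg (h * k)%g (a *: x)].

Definition graded_submodule (G : groupType) (R : comNzRingType)
    (M : lmodType R) (Mg : G -> set M) (K : set M) : Prop :=
  submod_closed [in K] /\ internal_direct_sum (fun h => K `&` Mg h) K.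

Definition colon (R : comNzRingType) (M : lmodType R) (K : set M) : set R :=
  [set r | forall x : M, K (r *: x)].

Definition annihilator (R : comNzRingType) (M : lmodType R) (m : M) : set R :=
  [set r | r *: m = 0].

Definition cyclic_submodule (R : comNzRingType) (M : lmodType R) (m : M) :
  set M := [set r *: m | r in [set: R]].

Definition ideal_mul (R : comNzRingType) (M : lmodType R) (I : set R)
    (K : set M) : set M :=
  [set x | exists (n : nat) (a : 'I_n -> R) (y : 'I_n -> M),
     [/\ forall i, I (a i), forall i, K (y i) & x = \sum_(i < n) a i *: y i]].

Definition phi1 (R : comNzRingType) (M : lmodType R) (K : set M) : set M :=
  ideal_mul (colon K) K.

Section GPrime.
Variables (G : groupType) (R : comNzRingType) (Rg : G -> set R).
Variables (M : lmodType R) (Mg : G -> set M) (g : G).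

Definition g_prime (K : set M) : Prop :=
  [/\ graded_submodule Mg K, K `&` Mg g <> Mg g
    & forall r x, Rg 1%g r -> Mg g x -> K (r *: x) -> K x \/ colon K r].

Definition g_phi1_prime (K : set M) : Prop :=
  [/\ graded_submodule Mg K, K `&` Mg g <> Mg g
    & forall r x, Rg 1%g r -> Mg g x ->
        (K `\` phi1 K) (r *: x) -> K x \/ colon K r].

End GPrime.

(* For [m] homogeneous, [R m] is graded with [(R m)_g = R_e m].  Hence the first
   two conjuncts of [g_prime] and [g_phi1_prime] hold for [R m] as soon as
   [R_e m <> M_g], and negating these predicates negates only their last
   conjunct. *)
Section Cyclic.
Variables (G : groupType) (R : comNzRingType) (Rg : G -> set R).
Variables (M : lmodType R) (Mg : G -> set M) (g : G) (m : M).
Hypotheses (gR : graded_ring Rg) (gM : graded_module Rg Mg) (mg : Mg g m).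

Lemma cyclic_decomposition r f : decomposition Rg r f ->
  decomposition Mg (r *: m) (fun k => f (k * g^-1)%g *: m).
Proof.
case: gM => _ _ RM [ff fR ->]; split.
- apply: (sub_finite_set _ (finite_image (fun h => (h * g)%g) ff)) => k /= nz.
  exists (k * g^-1)%g; last by rewrite mulgVK.
  by apply: contra_neq nz => ->; rewrite scale0r.
- by move=> k; have := RM _ _ _ _ (fR (k * g^-1)%g) mg; rewrite mulgVK.
- rewrite [RHS](reindex_fsbigT (fun h => (h * g)%g)) /=; last first.
    by exists (fun h => (h * g^-1)%g) => h; rewrite ?mulgK ?mulgVK.
  under [in RHS]eq_fsbigr do rewrite mulgK.
  set S := [set h | f h != 0] in ff.
  rewrite (fsbigTE (fset_set S)); last first.
    by move=> h; rewrite in_fset_set // notin_setE /= => /negP; rewrite negbK => /eqP.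
  rewrite (fsbigTE (fset_set S)); last first.
    move=> h; rewrite in_fset_set // notin_setE /= => /negP; rewrite negbK.
    by move=> /eqP ->; rewrite scale0r.
  by rewrite scaler_suml.
Qed.

Lemma cyclic_graded : graded_submodule Mg (cyclic_submodule m).
Proof.
split; first split.
- by rewrite inE; exists 0 => //; rewrite scale0r.
- move=> a x y; rewrite !inE => -[r _ <-] [s _ <-].
  by exists (a * r + s) => //; rewrite scalerDl scalerA.
split=> [h x []//|_ [r _ <-]].
case: gR => _ [_ /(_ r I) [f [fP _]]] _.
have [ff fM e] := cyclic_decomposition fP.
exists (fun k => f (k * g^-1)%g *: m); split.
  by split=> // h; split=> //; exists (f (h * g^-1)%g).
move=> f' [ff' fK e'].
case: gM => _ [_ /(_ (r *: m) I) [f0 [_ u]]] _.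
rewrite -(u (fun k => f (k * g^-1)%g *: m)); last by split.
by apply: u; split=> // h; have [] := fK h.
Qed.

Lemma cyclic_component :
  cyclic_submodule m `&` Mg g = [set r *: m | r in Rg 1%g].
Proof.
case: (gM) => MZ [_ Mu] RM.
rewrite eqEsubset; split=> [x [[r _ rm] Mx]|_ [r r1 <-]]; last first.
  by split; [exists r | have := RM _ _ _ _ r1 mg; rewrite mul1g].
case: gR => _ [_ /(_ r I) [f [fP _]]] _.
have := cyclic_decomposition fP; rewrite rm => D.
have [f0 [_ u]] := Mu x I.
exists (f 1%g); first by case: fP.
have D' : decomposition Mg x (fun k => if k == g then x else 0).
  split.
  - apply: (sub_finite_set _ (finite_set1 g)) => k /=.
    by case: (k =P g) => // _; rewrite eqxx.
  - by move=> k; case: (k =P g) => [->//|_]; have [] := MZ k; rewrite inE.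
  - rewrite (fsbigTE [fset g]%fset) ?big_seq_fset1 => [|k]; first by rewrite eqxx.
    by rewrite inE => /negPf ->.
have /(congr1 (@^~ g)) /= := etrans (esym (u _ D)) (u _ D').
by rewrite divgg eqxx.
Qed.

End Cyclic.

(* Main.v *)
Require Import Defs.
From mathcomp Require Import all_boot all_order all_algebra.
From mathcomp Require Import boolp classical_sets.

(** Suppose that [K = R m] is g-phi_1-prime; it is then shown to be g-prime.
    Take [r] in [R_e] and [x] in [M_g] with [r x] in [K] and [x] outside [K].
    Since [m] lies in [K], the translate [x + m] is also outside [K], while
    [r (x + m)] is still in [K].  If [r x] or [r (x + m)] avoids [phi_1(K)],
    then the hypothesis on [K] gives [r] in [(K : M)].  Otherwise the
    difference [r m] of the two is in [phi_1(K) = (K : M) m]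
    ([ideal_mul_cyclic]), say [r m = a m] with [a] in [(K : M)]; as [m] has
    zero annihilator, [r = a]. *)

Set Implicit Arguments.
Unset Strict Implicit.
Unset Printing Implicit Defensive.

Import GRing.Theory.
Local Open Scope classical_set_scope.
Local Open Scope ring_scope.

Lemma colon_submod_closed (R : comNzRingType) (M : lmodType R) (K : set M) :
  submod_closed [in K] -> submod_closed [in (colon K : set R^o)].
Proof.
move=> [K0 KD]; split; first by rewrite inE => x; rewrite scale0r -inE.
move=> a u v; rewrite !inE => Ku Kv x.
by rewrite scalerDl -scalerA -inE; apply: KD; rewrite inE.
Qed.

(** Each term [a (s m)] of an element of [I (R m)] equals [(s a) m], so the
    coefficients of a finite sum collect into one element of the ideal [I]. *)
Lemma ideal_mul_cyclic (R : comNzRingType) (M : lmodType R) (I : set R)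
    (m : M) :
  submod_closed [in (I : set R^o)] ->
  ideal_mul I (cyclic_submodule m) `<=` [set a *: m | a in I].
Proof.
move=> [I0 ID] _ [n [a [y [Ia ym ->]]]].
apply: (big_ind [set a *: m | a in I]).
- by exists 0; rewrite ?scale0r // -inE.
- move=> _ _ [b Ib <-] [c Ic <-]; exists (b + c); last by rewrite scalerDl.
  by have := ID 1 b c; rewrite !inE scale1r; apply.
- move=> i _; have [s _ <-] := ym i.
  exists (s * a i); last by rewrite scalerA mulrC.
  by have := ID s (a i) 0; rewrite addr0 !inE; apply=> //; rewrite -inE.
Qed.

Lemma annihilator0_scaler_inj (R : comNzRingType) (M : lmodType R) (m : M) :
  annihilator m = [set 0] -> injective (fun r : R => r *: m).
Proof.
move=> ann r s /= rs; apply/eqP; rewrite -subr_eq0; apply/eqP.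
have : annihilator m (r - s) by rewrite /annihilator /= scalerBl rs subrr.
by rewrite ann.
Qed.

Theorem theorem2p6 (G : groupType) (R : comNzRingType) (Rg : G -> set R)
    (M : lmodType R) (Mg : G -> set M)
    (hR : graded_ring Rg) (hM : graded_module Rg Mg)
    (g : G) (m : M) (m_neq0 : m != 0) (hm : Mg g m)
    (hRem : [set r *: m | r in Rg 1%g] <> Mg g)
    (hann : annihilator m = [set 0]) :
  ~ g_prime Rg Mg g (cyclic_submodule m) ->
  ~ g_phi1_prime Rg Mg g (cyclic_submodule m).
Proof.
set K := cyclic_submodule m.
apply: contra_not => -[grK Kg Kprime]; split=> // r x Rr Mx Krx.
have [Kx|nKx] := pselect (K x); [by left | right].
have Kclosed : submod_closed [in K] by case: grK.
have Cclosed := colon_submod_closed Kclosed.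
have phiK := ideal_mul_cyclic (m := m) Cclosed.
have KD y z : K y -> K z -> K (y + z).
  by have := Kclosed.2 1 y z; rewrite !inE scale1r.
have KB y z : K y -> K z -> K (y - z).
  move=> Ky Kz; rewrite addrC -scaleN1r.
  by have := Kclosed.2 (-1) z y; rewrite !inE; apply.
have Km : K m by exists 1; rewrite ?scale1r.
have Mxm : Mg g (x + m).
  have MgZ : zmod_closed [in Mg g] by case: hM.
  by have := (GRing.zmod_closedD MgZ).2 x m; rewrite !inE; apply.
have nKxm : ~ K (x + m).
  by move=> Kxm; apply: nKx; rewrite -(addrK m x); apply: KB.
have Krxm : K (r *: (x + m)) by rewrite scalerDr; apply: KD => //; exists r.
have [/phiK [a Ca ax]|nphi] := pselect (phi1 K (r *: x)); last first.
  by have [] := Kprime r x Rr Mx.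
have [/phiK [b Cb bxm]|nphi] := pselect (phi1 K (r *: (x + m))); last first.
  by have [] := Kprime r (x + m) Rr Mxm.
have -> : r = (-1) * a + b.
  apply: (annihilator0_scaler_inj hann) => /=.
  by rewrite scalerDl mulN1r scaleNr ax bxm scalerDr addKr.
by have := Cclosed.2 (-1) a b; rewrite !inE; apply.
Qed.
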